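(* Let $K$ be a $^*$-continuous KAT with top, let $(A,\le_A)$ be a top Kleene abstract domain of $K$ with maps $\alpha:\mathrm{TOP}(K)\to A$ and $\gamma:A\to\mathrm{TOP}(K)$, and let $T_{\Sigma,B}$ be a KAT language interpreted on $K$. For all $p^\sharp,q^\sharp\in A$, $a\in K$ and $t\in T_{\Sigma,B}$: (monotonicity) if $p^\sharp\le_A q^\sharp$ then $\mathcal S^\sharp[t]\,p^\sharp\le_A\mathcal S^\sharp[t]\,q^\sharp$; (soundness) $\alpha(\top a\llbracket t\rrbracket_u)\le_A\mathcal S^\sharp[t]\,\alpha(\top a)$.
   Context: Idempotent semiring: $(K,+,0)$ commutative monoid with $a+a=a$, $(K,\cdot,1)$ monoid, two-sided distributivity, $0a=a0=0$; $a\le b$ iff $a+b=b$. KAT: idempotent semiring with Boolean subalgebra $\mathrm{Test}(K)$ (join $+$, meet $\cdot$, complement, bottom $0$, top $1$) and ${}^*$ with $1+aa^*\le a^*$, $1+a^*a\le a^*$, $b+ac\le c\Rightarrow a^*b\le c$, $b+ca\le c\Rightarrow ba^*\le c$. A TopKAT is a KAT with a greatest element $\top$ ($a\le\top$ for all $a$). It is $^*$-continuous (TopKAT$^*$) if for all $a,b,c\in K$ the lub $\bigvee_{n\in\mathbb N}ab^nc$ exists and equals $ab^*c$. $\mathrm{TOP}(K):=\{\top a\mid a\in K\}$ ordered by $\le$. Language: disjoint $\Sigma,B$ ($\mathtt0,\mathtt1\in B$), $\mathrm{Atom}=\Sigma\cup B$, terms $t::=\mathtt a\mid\mathtt0\mid\mathtt1\mid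 t_1+t_2\mid t_1\cdot t_2\mid t^*$; evaluation $u:\mathrm{Atom}\to K$ with $u(B)\subseteq\mathrm{Test}(K)$, extended homomorphically (sum, product, star) to $\llbracket\cdot\rrbracket_u:T_{\Sigma,B}\to K$. A top Kleene abstract domain of $K$: poset $(A,\le_A)$ with a Galois insertion $\alpha:\mathrm{TOP}(K)\to A$, $\gamma:A\to\mathrm{TOP}(K)$ ($\alpha(x)\le_Ay\iff x\le\gamma(y)$, $\alpha\gamma=\mathrm{id}$) such that every countable subset of $A$ has a lub. Abstract semantics: $\mathcal S^\sharp[\mathtt c]x=\alpha(\gamma(x)\llbracket\mathtt c\rrbracket_u)$ for $\mathtt c\in\mathrm{Atom}$, $\mathcal S^\sharp[t_1+t_2]x=\mathcal S^\sharp[t_1]x\vee_A\mathcal S^\sharp[t_2]x$, $\mathcal S^\sharp[t_1\cdot t_2]x=\mathcal S^\sharp[t_2](\mathcal S^\sharp[t_1]x)$, $\mathcal S^\sharp[t^*]x=\bigvee_n(\mathcal S^\sharp[t])^nx$. *)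

(* Defs.v *)
From HB Require Import structures.
From mathcomp Require Import all_boot all_order all_algebra.
From mathcomp Require Import boolp classical_sets cardinality.

Set Implicit Arguments.
Unset Strict Implicit.
Unset Printing Implicit Defensive.

Local Open Scope classical_set_scope.
Local Open Scope ring_scope.

HB.mixin Record PzSemiRing_isIdempotent (K : Type) of GRing.PzSemiRing K := {
  kaddxx : forall a : K, a + a = a
}.

#[short(type="idemSemiRingType")]
HB.structure Definition IdemSemiRing :=
  { K of GRing.PzSemiRing K & PzSemiRing_isIdempotent K }.

Definition kle (K : idemSemiRingType) (a b : K) : Prop := a + b = b.

Notation "a <=k b" := (kle a b) (at level 70, no associativity) : ring_scope.

Definition is_klub (K : idemSemiRingType) (S : set K) (x : K) : Prop :=
  (forall a, S a -> a <=k x) /\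
  (forall y, (forall a, S a -> a <=k y) -> x <=k y).

(* The laws of a Boolean algebra for join [+], meet [*], bottom [0] and top [1];
   those that hold for all elements of an idempotent semiring (associativity
   of both operations, commutativity and idempotence of [+], the unit laws and
   distributivity of [*] over [+]) are not repeated.  The values of [compl]
   outside [B] are irrelevant. *)
Record boolean_subalgebra (K : idemSemiRingType) (B : set K) (compl : K -> K)
    : Prop := BooleanSubalgebra {
  test0 : B 0;
  test1 : B 1;
  testD : forall p q, B p -> B q -> B (p + q);
  testM : forall p q, B p -> B q -> B (p * q);
  testC : forall p, B p -> B (compl p);
  test_mulC : forall p q, B p -> B q -> p * q = q * p;
  test_mulxx : forall p, B p -> p * p = p;
  test_addKM : forall p q, B p -> B q -> p + p * q = p;
  test_mulKD : forall p q, B p -> B q -> p * (p + q) = p;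
  test_addMr : forall p q r, B p -> B q -> B r ->
    p + q * r = (p + q) * (p + r);
  test_addC : forall p, B p -> p + compl p = 1;
  test_mulCx : forall p, B p -> p * compl p = 0
}.

HB.mixin Record IdemSemiRing_isKAT (K : Type) of IdemSemiRing K := {
  Test : set K;
  kcompl : K -> K;
  Test_boolean : boolean_subalgebra Test kcompl;
  star : K -> K;
  star_unfoldl : forall a : K, 1 + a * star a <=k star a;
  star_unfoldr : forall a : K, 1 + star a * a <=k star a;
  star_indl : forall a b c : K, b + a * c <=k c -> star a * b <=k c;
  star_indr : forall a b c : K, b + c * a <=k c -> b * star a <=k c
}.

#[short(type="katType")]
HB.structure Definition KAT :=
  { K of IdemSemiRing K & IdemSemiRing_isKAT K }.

HB.mixin Record KAT_hasTop (K : Type) of KAT K := {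
  ktop : K;
  kle_top : forall a : K, a <=k ktop
}.

#[short(type="topKATType")]
HB.structure Definition TopKAT := { K of KAT K & KAT_hasTop K }.

HB.mixin Record TopKAT_isStarContinuous (K : Type) of TopKAT K := {
  star_continuous : forall a b c : K,
    is_klub (range (fun n : nat => a * b ^+ n * c)) (a * star b * c)
}.

#[short(type="topKATStarType")]
HB.structure Definition TopKATStar :=
  { K of TopKAT K & TopKAT_isStarContinuous K }.

Definition TOP (K : topKATType) : set K := range (fun a : K => ktop * a).

Arguments TOP : clear implicits.

Lemma topmul_subproof (K : topKATType) (a : K) : ktop * a \in TOP K.
Proof. by apply/mem_set; exists a. Qed.

Definition topmul (K : topKATType) (a : K) : TOP K :=
  exist _ (ktop * a) (topmul_subproof a).

Lemma TOPmul_subproof (K : topKATType) (x : TOP K) (b : K) :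
  val x * b \in TOP K.
Proof.
case: x => x /= /set_mem[a _ <-]; apply/mem_set.
by exists (a * b) => //; rewrite GRing.mulrA.
Qed.

Definition TOPmul (K : topKATType) (x : TOP K) (b : K) : TOP K :=
  exist _ (val x * b) (TOPmul_subproof x b).

Record KATlang := KATLang {
  Sigma : Type;
  Bsym : Type;
  sym0 : Bsym;
  sym1 : Bsym;
  sym0_neq1 : sym0 <> sym1
}.

Definition Atom (L : KATlang) : Type := (Sigma L + Bsym L)%type.

(* The terms 0 and 1 are the atoms [inr (sym0 L)] and [inr (sym1 L)]. *)
Inductive term (L : KATlang) : Type :=
| TAtom of Atom L
| TAdd of term L & term L
| TMul of term L & term L
| TStar of term L.

Definition evaluation (L : KATlang) (K : katType) (u : Atom L -> K) : Prop :=
  forall b : Bsym L, Test (u (inr b)).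

Fixpoint sem (L : KATlang) (K : katType) (u : Atom L -> K) (t : term L) : K :=
  match t with
  | TAtom c => u c
  | TAdd t1 t2 => sem u t1 + sem u t2
  | TMul t1 t2 => sem u t1 * sem u t2
  | TStar t1 => star (sem u t1)
  end.

Record top_Kleene_abstract_domain (K : topKATType) (d : Order.disp_t)
    (A : porderType d) (alpha : TOP K -> A) (gamma : A -> TOP K) : Prop :=
  TopKleeneAbstractDomain {
    dom_galois : forall (x : TOP K) (y : A),
      (alpha x <= y)%O <-> val x <=k val (gamma y);
    dom_insertion : forall y : A, alpha (gamma y) = y;
    dom_countable_lub : forall S : set A,
      countable S -> exists x : A, supremums S x
  }.

(* [supremum x S] is the least upper bound of [S] when [S] is nonempty and has
   one; the sets below are countable and nonempty, so the default value [x] is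
   never used in a top Kleene abstract domain. *)
Fixpoint abs_sem (K : topKATType) (d : Order.disp_t) (A : porderType d)
    (alpha : TOP K -> A) (gamma : A -> TOP K)
    (L : KATlang) (u : Atom L -> K) (t : term L) (x : A) : A :=
  match t with
  | TAtom c => alpha (TOPmul (gamma x) (u c))
  | TAdd t1 t2 =>
      supremum x [set abs_sem alpha gamma u t1 x; abs_sem alpha gamma u t2 x]
  | TMul t1 t2 => abs_sem alpha gamma u t2 (abs_sem alpha gamma u t1 x)
  | TStar t1 =>
      supremum x (range (fun n : nat => iter n (abs_sem alpha gamma u t1) x))
  end.

(* Main.v *)
(** Soundness is proved in the concretised form: if [x] lies below [gamma y],
    then [x * sem u t] lies below [gamma] of the abstract semantics of [t] at
    [y].  Here [x] ranges over all of [K], so the induction needs no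
    membership in [TOP K], and star-continuity reduces the
    case of [t^*] to the powers of [t].  The Galois connection then gives the
    form with [alpha]. *)

Require Import Defs.
From mathcomp Require Import all_boot all_order all_algebra.
From mathcomp Require Import boolp classical_sets cardinality.

Set Implicit Arguments.
Unset Strict Implicit.
Unset Printing Implicit Defensive.

Import Order.POrderTheory GRing.Theory.

Local Open Scope classical_set_scope.
Local Open Scope ring_scope.

Section IdemSemiRingOrder.
Variable K : idemSemiRingType.
Implicit Types a b c : K.

Lemma kle_trans a b c : a <=k b -> b <=k c -> a <=k c.
Proof. by rewrite /kle => ab bc; rewrite -bc addrA ab. Qed.

Lemma kle_mulr c a b : a <=k b -> a * c <=k b * c.
Proof. by rewrite /kle -mulrDl => ->. Qed.

Lemma kle_add a b c : a <=k c -> b <=k c -> a + b <=k c.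
Proof. by rewrite /kle -addrA => ac ->. Qed.

End IdemSemiRingOrder.

(** [supremum] falls back on [x0] for an empty set and for a set without a least upper bound; the
    two hypotheses exclude these cases. *)
Lemma supremums_supremum (d : Order.disp_t) (A : porderType d) (x0 : A)
    (S : set A) :
  S !=set0 -> supremums S !=set0 -> supremums S (supremum x0 S).
Proof.
by move=> /set0P S0 supS; rewrite /supremum (negbTE S0); exact: xgetPex.
Qed.

Section AbstractSemantics.
Variables (K : topKATType) (d : Order.disp_t) (A : porderType d).
Variables (alpha : TOP K -> A) (gamma : A -> TOP K).
Hypothesis hA : top_Kleene_abstract_domain alpha gamma.

(** The unit of the Galois connection: [dom_galois] at [alpha x], by reflexivity. *)
Lemma kle_gamma_alpha (x : TOP K) : val x <=k val (gamma (alpha x)).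
Proof. by apply/(dom_galois hA). Qed.

Lemma gamma_mono (y z : A) : (y <= z)%O -> val (gamma y) <=k val (gamma z).
Proof. by move=> yz; apply/(dom_galois hA); rewrite (dom_insertion hA). Qed.

Lemma alpha_mono (x y : TOP K) : val x <=k val y -> (alpha x <= alpha y)%O.
Proof.
by move=> xy; apply/(dom_galois hA)/(kle_trans xy)/kle_gamma_alpha.
Qed.

Lemma supremum_rangeP (x0 : A) (f : nat -> A) :
  (forall n, (f n <= supremum x0 (range f))%O) /\
  (forall y, (forall n, (f n <= y)%O) -> (supremum x0 (range f) <= y)%O).
Proof.
have [||ub lub] := @supremums_supremum _ _ x0 (range f).
- by exists (f 0%N); exists 0%N.
- apply: (dom_countable_lub hA).
  exact: (sub_countable (card_image_le _ _) (countableP _)).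
split=> [n|y fy]; first by apply: ub; exists n.
by apply: lub => _ [n _ <-].
Qed.

(** [A] is only a poset, so binary joins come from the countable least upper bounds: a pair is
    finite, hence countable. *)
Lemma supremum_pairP (x0 y z : A) :
  [/\ (y <= supremum x0 [set y; z])%O, (z <= supremum x0 [set y; z])%O &
      forall w, (y <= w)%O -> (z <= w)%O -> (supremum x0 [set y; z] <= w)%O].
Proof.
have [||ub lub] := @supremums_supremum _ _ x0 [set y; z].
- by exists y; left.
- apply: (dom_countable_lub hA); apply: finite_set_countable.
  exact: finite_set2.
split=> [||w yw zw]; [by apply: ub; left|by apply: ub; right|].
by apply: lub => _ [] ->.
Qed.

Variables (L : KATlang) (u : Atom L -> K).

(** An atom acts by a composite of three monotone maps. For sums and stars, each member of the set
    at [p] lies below the matching member of the set at [q]. *)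
Lemma abs_sem_mono (t : term L) :
  {homo abs_sem alpha gamma u t : p q / (p <= q)%O}.
Proof.
elim: t => [c|t1 IH1 t2 IH2|t1 IH1 t2 IH2|t IH] p q pq /=.
- exact/alpha_mono/kle_mulr/gamma_mono.
(* The first pattern captures the value of [t1] at [q]; the second then finds that of [t2]. *)
- set y1 := abs_sem _ _ _ _ q; set y2 := abs_sem _ _ _ _ q.
  have [le1 le2 _] := supremum_pairP q y1 y2.
  have [_ _] := supremum_pairP p (abs_sem alpha gamma u t1 p)
    (abs_sem alpha gamma u t2 p); apply.
  + exact: le_trans (IH1 _ _ pq) le1.
  + exact: le_trans (IH2 _ _ pq) le2.
- exact/IH2/IH1.
- have [_] := supremum_rangeP p
    (fun n => iter n (abs_sem alpha gamma u t) p); apply=> n.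
  have [le_sup _] := supremum_rangeP q
    (fun n => iter n (abs_sem alpha gamma u t) q).
  apply: le_trans (le_sup n).
  by elim: n => //= n; exact: IH.
Qed.

End AbstractSemantics.

Lemma abs_sem_sound (K : topKATStarType) (d : Order.disp_t) (A : porderType d)
    (alpha : TOP K -> A) (gamma : A -> TOP K)
    (hA : top_Kleene_abstract_domain alpha gamma)
    (L : KATlang) (u : Atom L -> K) (t : term L) (x : K) (y : A) :
  x <=k val (gamma y) ->
  x * sem u t <=k val (gamma (abs_sem alpha gamma u t y)).
Proof.
elim: t x y => [c|t1 IH1 t2 IH2|t1 IH1 t2 IH2|t IH] x y xy /=.
- apply: kle_trans (kle_mulr (u c) xy) _.
  exact: (kle_gamma_alpha hA (TOPmul (gamma y) (u c))).
- have [le1 le2 _] := supremum_pairP hA y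
    (abs_sem alpha gamma u t1 y) (abs_sem alpha gamma u t2 y).
  rewrite mulrDr; apply: kle_add.
  + exact: kle_trans (IH1 _ _ xy) (gamma_mono hA le1).
  + exact: kle_trans (IH2 _ _ xy) (gamma_mono hA le2).
(* [IH2] is used at [x * sem u t1] and the abstract value of [t1] at [y], so [x] and [y] must be
   general in the induction. *)
- by rewrite mulrA; exact/IH2/IH1.
(* The factor [1] gives the product the two-sided shape [a * star b * c] of [star_continuous]. *)
- rewrite -[x * _]mulr1.
  have [_] := star_continuous x (sem u t) 1; apply=> _ [n _ <-].
  rewrite mulr1.
  have [le_sup _] := supremum_rangeP hA y
    (fun n => iter n (abs_sem alpha gamma u t) y).
  apply: kle_trans (gamma_mono hA (le_sup n)).
  elim: n => [|n IHn] /=; first by rewrite expr0 mulr1.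
  (* Splitting off the last factor matches the outermost step of [iter]; [IH] applies to
     [x * sem u t ^+ n] and the [n]-th iterate. *)
  by rewrite exprSr mulrA; exact: IH.
Qed.

Theorem theorem8 (K : topKATStarType) (d : Order.disp_t) (A : porderType d)
    (alpha : TOP K -> A) (gamma : A -> TOP K)
    (hA : top_Kleene_abstract_domain alpha gamma)
    (L : KATlang) (u : Atom L -> K) (hu : evaluation u) :
  forall (p q : A) (a : K) (t : term L),
    ((p <= q)%O ->
       (abs_sem alpha gamma u t p <= abs_sem alpha gamma u t q)%O) /\
    (alpha (TOPmul (topmul a) (sem u t))
       <= abs_sem alpha gamma u t (alpha (topmul a)))%O.
Proof.
move=> p q a t; split; first exact: abs_sem_mono.
apply/(dom_galois hA)/abs_sem_sound => //.
exact: (kle_gamma_alpha hA (topmul a)).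
Qed.
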